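(* Let $m$ be a positive integer and let $G=\mathrm{Cay}(\mathbb{Z}/m\mathbb{Z},S)$ be a Cayley graph such that $S$ contains a generator of the cyclic group $\mathbb{Z}/m\mathbb{Z}$. If any pair of (distinct) vertices of $G$ has at least $1$ common neighbor, and if there exists at least $1$ pair of (distinct) vertices of $G$ with at least $2$ common neighbors, then $G$ is pancyclic.
   Context: For a finite group $H$ and a subset $S\subseteq H$ that does not contain the identity element of $H$, is closed under taking inverses, and generates $H$, the Cayley graph $\mathrm{Cay}(H,S)$ is the simple undirected graph with vertex set $H$ in which $g$ and $h$ are adjacent if and only if $gh^{-1}\in S$. Here $\mathbb{Z}/m\mathbb{Z}$ is regarded as an additive group, so $u$ and $v$ are adjacent if and only if $u-v\in S$. An undirected graph of order $n\ge 3$ is pancyclic if it contains a $k$-cycle as a (not necessarily induced) subgraph for every $k\in\{3,4,\ldots,n\}$. *)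

(* Defs.v *)
From mathcomp Require Import all_boot all_algebra all_fingroup all_solvable.

Set Implicit Arguments.
Unset Strict Implicit.
Unset Printing Implicit Defensive.

Section Graph.

Variables (T : finType) (e : rel T).

Definition common_neighbors (x y : T) : {set T} := [set z | e x z & e y z].

(* For k >= 3, [ucycle e c] with [size c = k] says that the k vertices of [c]
   are distinct and cyclically adjacent, i.e. that they form a k-cycle of the
   simple graph [e].  (For smaller k it would also accept single edges.) *)
Definition has_cycle (k : nat) : Prop :=
  exists2 c : seq T, ucycle e c & size c = k.

Definition pancyclic : Prop :=
  2 < #|T| /\ forall k : nat, 2 < k <= #|T| -> has_cycle k.

End Graph.

Section Cayley.

Local Open Scope group_scope.

Variable gT : finGroupType.

Definition connection_set (S : {set gT}) : Prop :=
  [/\ 1 \notin S,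
      forall x, x \in S -> x^-1 \in S
    & <<S>> = [set: gT]].

Definition cayley (S : {set gT}) : rel gT := fun g h => g * h^-1 \in S.

Lemma cayley_irrefl S : connection_set S -> irreflexive (cayley S).
Proof. by case=> S1 _ _ g; rewrite /cayley mulgV; apply: negbTE. Qed.

Lemma cayley_sym S : connection_set S -> symmetric (cayley S).
Proof.
case=> _ SV _ g h; rewrite /cayley.
by apply/idP/idP=> /SV; rewrite invMg invgK.
Qed.

End Cayley.

(* The cyclic group of order m for every m > 0, including m = 1, where ['Z_m]
   would be Z/2Z.  (For m = 0 this is the trivial group.) *)
Notation Zmod m := 'I_(m.-1.+1).

Lemma card_Zmod (m : nat) : 0 < m -> #|{: Zmod m}| = m.
Proof. by move=> m_gt0; rewrite card_ord prednK. Qed.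

(* The group structure of [Zmod m] is the additive one. *)
Lemma cayley_ZmodE (m : nat) (S : {set Zmod m}) (u v : Zmod m) :
  cayley S u v = ((u - v)%R \in S).
Proof. by []. Qed.

(* Main.v *)
Require Import Defs.
From mathcomp Require Import all_boot all_algebra all_fingroup all_solvable.
From mathcomp Require Import zify.

(** Let a be a generator of the cyclic group of order m with a in S.  A common
    neighbor of a and of the identity is an element z = a^(c+1) of S such that
    a^c is also in S.  Replacing (c, c+1) by (m-c-1, m-c) if necessary, since S
    is closed under inverses, one may assume 0 < c and 2c < m
    ([cayley_pancyclic_triangle]).  Naming a^x by the number x < m, the graph
    contains all edges joining numbers that differ by 1, c or c+1, that is, the
    integers wound into a triangular lattice with rows of length c, together
    with the edge from m-1 back to 0.  Cycles of all lengths already exist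
    among these edges ([strip_pancyclic]).

    - Cycles of length k <= m-c stay in the strip and never wrap around.  The
      edge {0,1} is completed to a k-cycle by a path whose vertices are all
      below k+c-1 ([arc_exists]).  This goes by steps of 2c on k: a cycle
      through the bottom edge of row 2 is spliced into a Hamiltonian cycle of
      rows 0 and 1 ([arc_grow]), and at most 2c+1 vertices fit into two rows
      and one more vertex ([arc_small]).  This needs c > 1; for c = 1 the path
      grows by one vertex at a time ([arc_square]).
    - Cycles of length k = m-c+t with 0 < t < c wrap around once.  They jump
      over c numbers, except that t of those are picked up by a zigzag
      0, c+1, 1, c+2, 2, ..., t, c+t+1, c+t+2, ..., m-1 ([zigzag_exists]).
    - For k = m the generator a itself yields the cycle 0, 1, ..., m-1. *)

(** * Cycles in triangulated strips *)

Section Strip.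

Variables (e : rel nat) (c : nat).
Hypothesis e_sym : symmetric e.
Hypothesis e1 : forall x, e x x.+1.
Hypothesis ec : forall x, e x (x + c).
Hypothesis ec1 : forall x, e x (x + c).+1.

Lemma path_ascend x n : path e x (iota x.+1 n).
Proof. by elim: n x => //= n IHn x; rewrite e1 IHn. Qed.

Lemma path_descend z x n : e z (x + n) -> path e z (rev (iota x n.+1)).
Proof.
have rev_iotaS k : rev (iota x k.+1) = x + k :: rev (iota x k).
  by rewrite -(addn1 k) iotaD rev_cat.
elim: n z => [|n IHn] z e_zx; rewrite rev_iotaS /= e_zx //.
by rewrite IHn // addnS e_sym.
Qed.

Lemma last_iota x n : last x (iota x.+1 n) = x + n.
Proof. by elim: n x => [|n IHn] x /=; rewrite ?addn0 // IHn addnS. Qed.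

(** A path with n + 2 vertices from x to x+1 (s lists the inner ones) closes up
    to a cycle when n > 0.  The upper bound, which exceeds by only c - 1 the one forced by
    the number of vertices, is what leaves so few lengths to the cycles that
    wrap around. *)
Definition short_arc x n s :=
  [/\ size s = n, path e x (rcons s x.+1), uniq s
    & all (fun y => x.+1 < y <= x + n + c) s].

(** Go up from x to x+c, right along the upper row, then back left along the
    lower row.  The upper row may extend one vertex further than the lower one
    because the descent can use either of the steps c and c+1; this takes care
    of the parity of n. *)
Lemma arc_small x n : 1 < c -> n < c.*2 -> exists s, short_arc x n s.
Proof.
move=> c_gt1 lt_n_2c; have [w_gt0|] := posnP n./2.
  (* No lower row to come back along: the edge itself, or a triangle on it. *)
  have [->|->] : n = 0 \/ n = 1 by lia.
    by exists [::]; split; rewrite //= e1.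
  exists [:: (x + c).+1]; split; rewrite //=; last by lia.
  by rewrite ec1 e_sym -addSn ec.
case Dw: n./2 => [|w] // _.
exists (iota (x + c) (w.+2 + odd n) ++ rev (iota x.+2 w)); split.
- by rewrite size_cat size_rev !size_iota; lia.
- rewrite rcons_cat -rev_cons -[_ :: _]/(iota x.+1 w.+1) cat_path /= ec.
  rewrite e1 path_ascend last_iota; apply: path_descend; rewrite e_sym.
  case: (odd n); first by have := ec1 (x.+1 + w); congr e; lia.
  by have := ec (x.+1 + w); congr e; lia.
- rewrite cat_uniq rev_uniq !iota_uniq andbT.
  by apply/hasPn=> y; rewrite mem_rev !mem_iota; lia.
- by apply/allP=> y; rewrite mem_cat mem_rev !mem_iota; lia.
Qed.

(** In the Hamiltonian cycle x, x+c, x+c+1, ..., x+2c-1, x+c-1, ..., x+1 of two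
    rows, the edge {x+c, x+c+1} is replaced by a detour along the given arc,
    whose ends x+2c and x+2c+1 lie just above. *)
Lemma arc_grow x n s :
  1 < c -> short_arc (x + c.*2) n s -> exists s', short_arc x (c.*2 + n) s'.
Proof.
move=> c_gt1 [size_s path_s uniq_s /allP s_bounds].
exists [:: x + c, x + c.*2 & rcons s (x + c.*2).+1
        ++ iota (x + c).+1 c.-1 ++ rev (iota x.+2 c.-2)].
split.
- by rewrite /= !size_cat size_rcons size_rev !size_iota; lia.
- rewrite !rcons_cons !rcons_cat -rev_cons.
  have ->: x.+1 :: iota x.+2 c.-2 = iota x.+1 c.-1.
    by case: c c_gt1 => [|[]].
  have e_rows: e (x + c) (x + c.*2) by rewrite -addnn addnA.
  rewrite /= ec e_rows !cat_path last_rcons path_s /=.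
  have Dc: c.-1 = c.-2.+1 by lia.
  rewrite {1 2}Dc /= path_ascend last_iota.
  have ->: e (x + c.*2).+1 (x + c).+1.
    by rewrite e_sym; have := ec (x + c).+1; congr e; lia.
  rewrite Dc path_descend // e_sym.
  by have := ec (x.+1 + c.-2); congr e; lia.
- rewrite /= !cat_uniq rcons_uniq uniq_s rev_uniq !iota_uniq !andbT /=.
  have notin_s y : y <= (x + c.*2).+1 -> y \notin s.
    by move=> le_y; apply/negP=> /s_bounds; lia.
  rewrite inE !mem_cat !mem_rcons !inE !mem_rev !mem_iota.
  rewrite !(negbTE (notin_s _ _)) ?andTb; try lia.
  apply/and4P; split; try lia.
  + apply/hasPn=> y; rewrite mem_cat mem_rev !mem_iota mem_rcons inE => Dy.
    by rewrite negb_or notin_s; lia.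
  + by apply/hasPn=> y; rewrite mem_rev !mem_iota; lia.
- apply/allP=> y; rewrite !inE !mem_cat mem_rcons inE mem_rev !mem_iota.
  have [/s_bounds|_] := boolP (y \in s); lia.
Qed.

(** Rows of length 1 leave no room for the detour of [arc_grow], but here the
    steps 1 and 2 allow x, x+2, then the arc from x+1 to x+2 backwards. *)
Lemma arc_square x n : c = 1 -> exists s, short_arc x n s.
Proof.
move=> c1; elim: n x => [|n IHn] x.
  by exists [::]; split; rewrite //= e1.
have [s [size_s path_s uniq_s /allP s_bounds]] := IHn x.+1.
exists (x.+2 :: rev s); split.
- by rewrite /= size_rev size_s.
- rewrite rcons_cons -rev_cons -[_ :: s](belast_rcons _ s x.+2) /=.
  have ->: e x x.+2 by have := ec1 x; rewrite c1 addn1.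
  rewrite -[X in path e X](last_rcons x.+1 s) rev_path.
  by rewrite (eq_path (e' := e)) // => y z; apply: e_sym.
- rewrite /= rev_uniq uniq_s mem_rev andbT.
  by apply/negP=> /s_bounds; lia.
- apply/allP=> y; rewrite inE mem_rev => /predU1P[->|/s_bounds]; lia.
Qed.

Lemma arc_exists x n : 0 < c -> exists s, short_arc x n s.
Proof.
move=> c_gt0; have [c_gt1|c_le1] := ltnP 1 c; last by apply: arc_square; lia.
have [q] := ubnP n; elim: q x n => // q IHq x n; rewrite ltnS => le_nq.
have [|le_2c_n] := ltnP n c.*2; first exact: arc_small.
have [|s /arc_grow[//|s']] := IHq (x + c.*2) (n - c.*2); first by lia.
by rewrite subnKC //; exists s'.
Qed.

(** The path x, x+c+1, x+1, x+c+2, ..., x+t alternates between two rows with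
    steps c+1 and -c, then runs along x+c+t+1, ..., x+c+t+r.  Describing its
    vertices up to permutation gives size, bounds and distinctness at once. *)
Lemma zigzag_exists x t r : exists s,
  [/\ path e x s, last x s = if r == 0 then x + t else x + c + t + r
    & perm_eq s (iota x.+1 t ++ iota (x + c).+1 (t + r))].
Proof.
elim: t x => [|t IHt] x.
  exists (iota (x + c).+1 r); case: r => [|r]; split; rewrite //= ?addn0 //.
    by rewrite ec1 path_ascend.
  by rewrite last_iota; lia.
have [s [path_s last_s perm_s]] := IHt x.+1.
exists [:: (x + c).+1, x.+1 & s]; split.
- by rewrite /= path_s ec1 e_sym -addSn ec.
- by rewrite /= last_s; case: eqP; lia.
- rewrite addSn /= perm_sym -cat_cons perm_catC /= perm_cons.
  by rewrite perm_catC /= perm_cons perm_sym.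
Qed.

Lemma strip_pancyclic m k :
  0 < c -> c.*2 < m -> e m.-1 0 -> 2 < k <= m ->
  exists s, [/\ path.cycle e s, uniq s, all (ltn^~ m) s & size s = k].
Proof.
move=> c_gt0 lt_2c_m e_wrap /andP[k_gt2 le_k_m].
have [->|k_neq_m] := eqVneq k m.
  exists (iota 0 m); split; rewrite ?iota_uniq ?size_iota //.
    have ->: m = m.-1.+1 by lia.
    by rewrite /= rcons_path path_ascend last_iota.
  by apply/allP=> y; rewrite mem_iota.
(* An arc with k vertices stays below k + c - 1, hence below m if k <= m - c. *)
have [small_k|large_k] := leqP k (m - c).
  have [s [size_s path_s uniq_s /allP s_bounds]] := arc_exists 0 (k - 2) c_gt0.
  exists (0 :: rcons s 1); split.
  - by rewrite /= rcons_path path_s last_rcons e_sym e1.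
  - rewrite /= mem_rcons inE /= rcons_uniq uniq_s andbT.
    by apply/andP; split; apply/negP=> /s_bounds.
  - apply/allP=> y; rewrite inE mem_rcons inE /=.
    by case/or3P=> [/eqP->|/eqP->|/s_bounds]; lia.
  - by rewrite /= size_rcons size_s; lia.
(* Jumping over c numbers leaves m - c of them, so t have to be picked up;
   then r > 0 because k < m, and the path ends at m - 1. *)
pose t := k - (m - c); pose r := m.-1 - (c + t).
have [s [path_s last_s perm_s]] := zigzag_exists 0 t r.
exists (0 :: s); split.
- rewrite /= rcons_path path_s last_s ifN; last by lia.
  by move: e_wrap; congr e; lia.
- rewrite /= (perm_uniq perm_s) (perm_mem perm_s) cat_uniq !iota_uniq.
  rewrite mem_cat !mem_iota /= andbT.
  by apply/hasPn=> y; rewrite !mem_iota; lia.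
- apply/allP=> y; rewrite inE (perm_mem perm_s) mem_cat !mem_iota /=; lia.
- by rewrite /= (perm_size perm_s) size_cat !size_iota; lia.
Qed.

End Strip.

(** * Cayley graphs of cyclic groups *)

Section CyclicCayley.

Local Open Scope group_scope.

Variables (gT : finGroupType) (S : {set gT}) (a : gT).
Hypothesis S_conn : connection_set S.
Hypothesis aS : a \in S.
Hypothesis a_gen : <[a]> = [set: gT].

Let pow_rel : rel nat := fun x y => cayley S (a ^+ x) (a ^+ y).

Lemma pow_rel_add d x : a ^+ d \in S -> pow_rel x (x + d)%N.
Proof.
case: S_conn => _ SV _ /SV; rewrite /pow_rel /cayley.
by rewrite addnC expgD invMg mulKVg.
Qed.

Lemma cayley_pancyclic_strip c : (0 < c)%N -> (c.*2 < #[a])%N ->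
  a ^+ c \in S -> a ^+ c.+1 \in S -> pancyclic (cayley S).
Proof.
move=> c_gt0 lt_2c_m acS ac1S.
have cardT: #|gT| = #[a] by rewrite orderE a_gen cardsT.
split=> [|k]; rewrite cardT; first by lia.
move=> k_bounds.
have [| | | | |s [cyc_s uniq_s /allP lt_s size_s]] :=
    @strip_pancyclic pow_rel c _ _ _ _ #[a] k c_gt0 lt_2c_m _ k_bounds.
- by move=> x y; apply: cayley_sym.
- by move=> x; rewrite -addn1; apply: pow_rel_add; rewrite expg1.
- by move=> x; apply: pow_rel_add.
- by move=> x; rewrite -addnS; apply: pow_rel_add.
- rewrite /pow_rel (cayley_sym S_conn) /cayley expg0 mul1g.
  have -> //: (a ^+ #[a].-1)^-1 = a; apply/eqP.
  by rewrite eq_invg_mul -expgSr prednK ?order_gt0 // expg_order.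
exists [seq a ^+ x | x <- s]; last by rewrite size_map.
rewrite /ucycle cycle_map cyc_s map_inj_in_uniq // => x y /lt_s ltx /lt_s lty.
by move/eqP; rewrite eq_expg_mod_order !modn_small // => /eqP.
Qed.

(** The elements 1, a and z are pairwise adjacent, so the generator a lies on a
    triangle; the two other sides have the consecutive exponents c and c+1.
    Inverting them gives the exponents m-c-1 and m-c, so that the smaller
    exponent can always be taken below m/2. *)
Lemma cayley_pancyclic_triangle z :
  z \in S -> z * a^-1 \in S -> pancyclic (cayley S).
Proof.
move=> zS zaS; case: (S_conn) => S1 SV _.
have: z \in <[a]> by rewrite a_gen inE.
case/cyclePmin=> i lt_im Dz; move: zS zaS; rewrite Dz.
case: i lt_im {Dz} => [|c] lt_cm; first by rewrite expg0 (negbTE S1).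
move=> ac1S; rewrite expgSr mulgK => acS.
have c_gt0: (0 < c)%N by case: c acS {lt_cm ac1S} => //; rewrite expg0 (negbTE S1).
have [lt_2c_m|le_m_2c] := ltnP c.*2 #[a].
  exact: cayley_pancyclic_strip lt_2c_m acS ac1S.
have oppS d d' : (d + d')%N = #[a] -> a ^+ d \in S -> a ^+ d' \in S.
  move=> Dd /SV; have -> //: (a ^+ d)^-1 = a ^+ d'; apply/eqP.
  by rewrite eq_invg_mul -expgD Dd expg_order.
apply: (@cayley_pancyclic_strip (#[a] - c.+1)); try lia.
  by apply: oppS ac1S; lia.
by apply: oppS acS; lia.
Qed.

End CyclicCayley.

Theorem theorem1p2 (m : nat) (m_gt0 : 0 < m) (S : {set Zmod m})
    (S_conn : connection_set S)
    (S_gen : exists2 a : Zmod m, a \in S & generator [set: Zmod m] a)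
    (common1 : forall u v : Zmod m, u != v ->
       1 <= #|common_neighbors (cayley S) u v|)
    (common2 : exists u v : Zmod m,
       u != v /\ 2 <= #|common_neighbors (cayley S) u v|) :
  pancyclic (cayley S).
Proof.
have [a aS a_gen] := S_gen; have [S1 SV _] := S_conn.
have a_neq1: a != 1%g by apply: contraNneq S1 => <-.
have /card_gt0P[z] := common1 a 1%g a_neq1.
rewrite inE /cayley => /andP[az_S z_S].
apply: (@cayley_pancyclic_triangle _ S a S_conn aS _ z).
- by apply/esym/eqP.
- by move/SV: z_S; rewrite mul1g invgK.
- by move/SV: az_S; rewrite invMg invgK.
Qed.
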